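(* There exists a $\mathbf{0}'$-computable instance $I_3^1$ of $\mathsf{RT}_3^1$ such that for every instance $I_2^1$ of $\mathsf{RT}_2^1$ there exists a non trivial solution $G$ to $I_2^1$ such that $G$ does not compute any non trivial solution to $I_3^1$.
   Context: An instance of $\mathsf{RT}_k^1$ is a function $c:\mathbb{N}\to\{1,\dots,k\}$. A non trivial solution to such an instance is an infinite set $H\subseteq\mathbb{N}$ on which $c$ is constant. $\mathbf{0}'$ denotes the halting problem; ''$G$ computes $H$'' means $H\le_T G$. *)

(* Defs.v *)
From mathcomp Require Import all_boot boolp classical_sets cardinality.
From mathcomp Require Import zify.
From Stdlib Require Cantor.

Set Implicit Arguments.
Unset Strict Implicit.
Unset Printing Implicit Defensive.

Local Open Scope classical_set_scope.

Notation pairn x y := (Cantor.to_nat (x, y)).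
Notation fstn n := (Cantor.of_nat n).1.
Notation sndn n := (Cantor.of_nat n).2.

(* Programs denote partial functions from nat to nat, represented by their
   graphs; several arguments are passed as one through the Cantor pairing, so
   that projections are [Cfst] and [Csnd]. *)

Inductive code : Type :=
| Czero
| Csucc
| Cfst
| Csnd
| Coracle
| Cpair of code & code
| Ccomp of code & code
| Crec of code & code
| Cmin of code.

(* h (x, 0) = f x and h (x, n + 1) = g (x, (n, h (x, n))) *)
Fixpoint rec_graph (f g : nat -> nat -> Prop) (x n y : nat) : Prop :=
  if n is n'.+1
  then exists2 r, rec_graph f g x n' r & g (pairn x (pairn n' r)) y
  else f x y.

(* The least y with f (x, y) = 0; the search diverges as soon as some
   f (x, z) with z < y does. *)
Definition min_graph (f : nat -> nat -> Prop) (x y : nat) : Prop :=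
  f (pairn x y) 0 /\ forall z, z < y -> exists v, f (pairn x z) v.+1.

Definition char_fun (A : set nat) (n : nat) : nat := n \in A.

(* [eval A e x y]: the program [e] with oracle [A] halts on input [x] with
   output [y]. *)
Fixpoint eval (A : set nat) (e : code) (x y : nat) : Prop :=
  match e with
  | Czero => y = 0
  | Csucc => y = x.+1
  | Cfst => y = fstn x
  | Csnd => y = sndn x
  | Coracle => y = char_fun A x
  | Cpair f g => exists u v, [/\ eval A f x u, eval A g x v & y = pairn u v]
  | Ccomp f g => exists2 u, eval A g x u & eval A f u y
  | Crec f g => rec_graph (eval A f) (eval A g) (fstn x) (sndn x) y
  | Cmin f => min_graph (eval A f) x y
  end.

Definition computable_in (A : set nat) (f : nat -> nat) : Prop :=
  exists e, forall x, eval A e x (f x).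

Definition turing_le (B A : set nat) : Prop := computable_in A (char_fun B).

Fixpoint encode (e : code) : nat :=
  match e with
  | Czero => 0
  | Csucc => 1
  | Cfst => 2
  | Csnd => 3
  | Coracle => 4
  | Cpair f g => 5 + 4 * pairn (encode f) (encode g)
  | Ccomp f g => 6 + 4 * pairn (encode f) (encode g)
  | Crec f g => 7 + 4 * pairn (encode f) (encode g)
  | Cmin f => 8 + 4 * encode f
  end.

(* With the empty oracle, [Coracle] is the constant 0, so this is about the
   unrelativized partial recursive functions. *)
Definition halting_problem : set nat :=
  [set n | exists e x, n = pairn (encode e) x /\ exists y, eval set0 e x y].

(* The k colors are numbered from 0. *)
Definition RT1_instance (k : nat) : Type := nat -> 'I_k.

Definition RT1_solution (k : nat) (c : RT1_instance k) (H : set nat) : Prop :=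
  infinite_set H /\ exists i, forall n, H n -> c n = i.

Lemma pairn_inj a b c d : pairn a b = pairn c d -> a = c /\ b = d.
Proof.
by move=> /(f_equal Cantor.of_nat); rewrite !Cantor.cancel_of_to => -[].
Qed.

Lemma encode_inj : injective encode.
Proof.
elim=> [|||||f IHf g IHg|f IHf g IHg|f IHf g IHg|f IHf];
  case=> [|||||f' g'|f' g'|f' g'|f'];
  rewrite /encode -/encode //; try (by move=> E; exfalso; lia);
  try by (move=> E; have /pairn_inj[/IHf-> /IHg->] :
          pairn (encode f) (encode g) = pairn (encode f') (encode g') by lia).
by move=> E; have /IHf-> : encode f = encode f' by lia.
Qed.

Lemma encode_surj n : exists e, encode e = n.
Proof.
elim/ltn_ind: n => n IH.
have [n5|n5] := ltnP n 5.
  by case: n n5 {IH} => [|[|[|[|[|//]]]]] _;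
    [exists Czero | exists Csucc | exists Cfst | exists Csnd | exists Coracle].
have [q [r [rlt nE]]] : exists q r, r < 4 /\ n = 5 + r + 4 * q.
  by exists ((n - 5) %/ 4), ((n - 5) %% 4); lia.
have le2 := Cantor.to_nat_non_decreasing (fstn q) (sndn q).
rewrite -surjective_pairing Cantor.cancel_to_of in le2.
have [|f fE] := IH (fstn q); first by lia.
have [|g gE] := IH (sndn q); first by lia.
have [|h hE] := IH q; first by lia.
have pE : pairn (encode f) (encode g) = q.
  by rewrite fE gE -surjective_pairing Cantor.cancel_to_of.
case: r rlt nE => [|[|[|[|//]]]] _ ->;
  [exists (Cpair f g)|exists (Ccomp f g)|exists (Crec f g)|exists (Cmin h)];
  by rewrite /encode -/encode ?pE ?hE; lia.
Qed.

Lemma eval_functional A e x y z : eval A e x y -> eval A e x z -> y = z.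
Proof.
elim: e x y z => [|||||f IHf g IHg|f IHf g IHg|f IHf g IHg|f IHf] x y z /=;
  try by move=> -> ->.
- move=> [u [v [fu gv ->]]] [u' [v' [fu' gv' ->]]].
  by rewrite (IHf _ _ _ fu fu') (IHg _ _ _ gv gv').
- by move=> [u gu fy] [u' gu' fz]; move: fy; rewrite (IHg _ _ _ gu gu') => /IHf; apply.
- elim: (sndn x) y z => [|n IHn] y z /=; first exact: IHf.
  by move=> [r hr gy] [r' hr' gz]; move: gy; rewrite (IHn _ _ hr hr') => /IHg; apply.
- move=> [fy ylt] [fz zlt]; case: (ltngtP y z) => // [/zlt|/ylt] [v fv].
  + by have := IHf _ _ _ fy fv.
  + by have := IHf _ _ _ fz fv.
Qed.

(* Main.v *)
Require Import Defs.
From mathcomp Require Import all_boot boolp classical_sets cardinality.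
From mathcomp Require Import zify.
From Stdlib Require Cantor.

Set Implicit Arguments.
Unset Strict Implicit.
Unset Printing Implicit Defensive.

Local Open Scope classical_set_scope.

(* Call X good if the complement of every color class of c3 is X-hyperimmune: for every
   X-computable h and every color i some interval [n, h n] is entirely colored i.
   The coloring c3 is made of consecutive blocks, colored 0, 1, 2, 0, ... in turn; the
   block starting at a is continued, using the halting problem, past the values at a
   of all the programs with code at most a, so that the empty set is good.

   Let A be the first color class of c2. If some infinite good X has finite
   intersection with A or its complement, a tail of X is the required solution.
   Otherwise use Mathias forcing with conditions (F_0, F_1, X), where F_0 is a finite
   subset of A, F_1 one of its complement and X is good and infinite. Given programs
   e_0, e_1 and a color i, search for each n for a bound u such that for every
   partition of X in two parts Y_0, Y_1, some e_s outputs at most u on n with oracle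
   F_s + E for some finite subset E of Y_s. If u = u(n) always exists, it is
   X-computable by compactness, so some [n, u(n)] is colored i, and the partition of X
   by A shows how to extend F_s so that e_s^G does not step out of that interval. If
   the search fails at n, the hyperimmune-free basis theorem provides a partition which
   witnesses this and both parts of which are good, and restricting X to an
   infinite part Y_s makes e_s^G diverge at n.

   Hence for each color i, the complement of the color class i is hyperimmune relative
   to one of the two generic sets, and for one of them this happens for two of the
   three colors. A solution H of color j computable in G gives the function
   "least element of H above n", contradicting hyperimmunity for some color i <> j. *)

(** * Closure properties of relative computability *)

Lemma fst_pairn a b : fstn (pairn a b) = a.
Proof. by rewrite Cantor.cancel_of_to. Qed.

Lemma snd_pairn a b : sndn (pairn a b) = b.
Proof. by rewrite Cantor.cancel_of_to. Qed.

Section Closure.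
Variable A : set nat.
Implicit Types f g h : nat -> nat.
Local Notation cmp := (computable_in A).

Lemma cmp_ext f g : f =1 g -> cmp f -> cmp g.
Proof. by move=> fg [e he]; exists e => x; rewrite -fg. Qed.

Lemma cmp_id : cmp (fun x => x).
Proof.
exists (Cpair Cfst Csnd) => x; exists (fstn x), (sndn x); split => //.
by rewrite -surjective_pairing Cantor.cancel_to_of.
Qed.

Lemma cmp_comp f g : cmp f -> cmp g -> cmp (fun x => f (g x)).
Proof. by move=> [e he] [d hd]; exists (Ccomp e d) => x; exists (g x). Qed.

Lemma cmp_pairn f g : cmp f -> cmp g -> cmp (fun x => pairn (f x) (g x)).
Proof. by move=> [e he] [d hd]; exists (Cpair e d) => x; exists (f x), (g x). Qed.

Lemma cmp_fst f : cmp f -> cmp (fun x => fstn (f x)).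
Proof. by move=> /(@cmp_comp (fun x => fstn x)); apply; exists Cfst. Qed.

Lemma cmp_snd f : cmp f -> cmp (fun x => sndn (f x)).
Proof. by move=> /(@cmp_comp (fun x => sndn x)); apply; exists Csnd. Qed.

Lemma cmp_succ f : cmp f -> cmp (fun x => (f x).+1).
Proof. by move=> /(@cmp_comp succn); apply; exists Csucc. Qed.

Lemma cmp_oracle f : cmp f -> cmp (fun x => char_fun A (f x)).
Proof. by move=> /(@cmp_comp (char_fun A)); apply; exists Coracle. Qed.

Lemma cmp_const n : cmp (fun=> n).
Proof. by elim: n => [|n]; [exists Czero | apply: cmp_succ]. Qed.

Definition cmp2 (f : nat -> nat -> nat) := cmp (fun z => f (fstn z) (sndn z)).

Definition cmp3 (f : nat -> nat -> nat -> nat) :=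
  cmp (fun z => f (fstn z) (fstn (sndn z)) (sndn (sndn z))).

Lemma cmp2_app (f : nat -> nat -> nat) g h :
  cmp2 f -> cmp g -> cmp h -> cmp (fun x => f (g x) (h x)).
Proof.
move=> cf cg ch; apply: cmp_ext (cmp_comp cf (cmp_pairn cg ch)) => x.
by rewrite fst_pairn snd_pairn.
Qed.

Lemma cmp3_app (f : nat -> nat -> nat -> nat) g h k :
  cmp3 f -> cmp g -> cmp h -> cmp k -> cmp (fun x => f (g x) (h x) (k x)).
Proof.
move=> cf cg ch ck.
apply: cmp_ext (cmp_comp cf (cmp_pairn cg (cmp_pairn ch ck))) => x.
by rewrite !(fst_pairn, snd_pairn).
Qed.

Lemma cmp_rec f (g : nat -> nat -> nat -> nat) h : cmp f -> cmp3 g -> cmp h ->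
  cmp (fun x => nat_rect (fun=> nat) (f x) (g x) (h x)).
Proof.
move=> [e he] [d hd] ch.
have cr : cmp2 (fun x n => nat_rect (fun=> nat) (f x) (g x) n).
  exists (Crec e d) => z /=; elim: (sndn z) => [|n IH] /=; first exact: he.
  set r := nat_rect _ _ _ n; exists r => //.
  by have := hd (pairn (fstn z) (pairn n r)); cbv beta; rewrite !(fst_pairn, snd_pairn).
exact: cmp2_app cr cmp_id ch.
Qed.

(** Since [f] is total, the search never meets a divergent value, so [g] only has to be recognised
    as the position of the first zero. *)
Lemma cmp_min (f : nat -> nat -> nat) g : cmp2 f ->
  (forall x, f x (g x) = 0) -> (forall x z, z < g x -> f x z != 0) -> cmp g.
Proof.
move=> [e he] f0 fmin; exists (Cmin e) => x; split=> [|z zlt].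
  by have := he (pairn x (g x)); cbv beta; rewrite fst_pairn snd_pairn f0.
exists (f x z).-1; rewrite prednK ?lt0n ?fmin //.
by have := he (pairn x z); cbv beta; rewrite fst_pairn snd_pairn.
Qed.

Lemma cmp_add f g : cmp f -> cmp g -> cmp (fun x => f x + g x).
Proof.
move=> cf cg.
have c3 : cmp3 (fun x k r => r.+1).
  by apply: cmp_succ; do 2!apply: cmp_snd; exact: cmp_id.
apply: cmp_ext (cmp_rec cg c3 cf) => x.
by elim: (f x) => [|n /= ->].
Qed.

Lemma cmp_mul f g : cmp f -> cmp g -> cmp (fun x => f x * g x).
Proof.
move=> cf cg.
have c3 : cmp3 (fun x k r => g x + r).
  apply: cmp_add; last by do 2!apply: cmp_snd; exact: cmp_id.
  by apply: cmp_comp cg _; apply: cmp_fst; exact: cmp_id.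
apply: cmp_ext (cmp_rec (cmp_const 0) c3 cf) => x.
by elim: (f x) => [|n /= ->].
Qed.

Lemma cmp_pred f : cmp f -> cmp (fun x => (f x).-1).
Proof.
move=> cf.
have c3 : cmp3 (fun x k r => k).
  by apply: cmp_fst; apply: cmp_snd; exact: cmp_id.
by apply: cmp_ext (cmp_rec (cmp_const 0) c3 cf) => x; case: (f x).
Qed.

Lemma cmp_sub f g : cmp f -> cmp g -> cmp (fun x => f x - g x).
Proof.
move=> cf cg.
have c3 : cmp3 (fun x k r => r.-1).
  by apply: cmp_pred; do 2!apply: cmp_snd; exact: cmp_id.
apply: cmp_ext (cmp_rec cf c3 cg) => x.
by elim: (g x) => [|n /= ->]; rewrite ?subn0 ?subnS.
Qed.

Lemma cmp_eq0 f : cmp f -> cmp (fun x => f x == 0).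
Proof.
move=> cf; apply: cmp_ext (cmp_sub (cmp_const 1) cf) => x.
by case: (f x) => [|n]; rewrite ?subn0 // subSS.
Qed.

Lemma cmp_leq f g : cmp f -> cmp g -> cmp (fun x => f x <= g x).
Proof. by move=> cf cg; apply: cmp_eq0; exact: cmp_sub. Qed.

Lemma cmp_ltn f g : cmp f -> cmp g -> cmp (fun x => f x < g x).
Proof. by move=> cf cg; apply: cmp_leq => //; exact: cmp_succ. Qed.

Lemma cmp_not (b : nat -> bool) : cmp (fun x => b x) -> cmp (fun x => ~~ b x).
Proof. by move=> /cmp_eq0; apply: cmp_ext => x; case: (b x). Qed.

Lemma cmp_and (b c : nat -> bool) :
  cmp (fun x => b x) -> cmp (fun x => c x) -> cmp (fun x => b x && c x).
Proof. by move=> cb /(cmp_mul cb); apply: cmp_ext => x; rewrite mulnb. Qed.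

Lemma cmp_or (b c : nat -> bool) :
  cmp (fun x => b x) -> cmp (fun x => c x) -> cmp (fun x => b x || c x).
Proof.
move=> cb cc; apply: cmp_ext (cmp_not (cmp_and (cmp_not cb) (cmp_not cc))) => x.
by rewrite negb_and !negbK.
Qed.

Lemma cmp_if (b : nat -> bool) f g : cmp (fun x => b x) -> cmp f -> cmp g ->
  cmp (fun x => if b x then f x else g x).
Proof.
move=> cb cf cg.
apply: cmp_ext (cmp_add (cmp_mul cb cf) (cmp_mul (cmp_not cb) cg)) => x.
by case: (b x); rewrite !(mul0n, mul1n, addn0).
Qed.

Lemma cmp_eq f g : cmp f -> cmp g -> cmp (fun x => f x == g x).
Proof.
move=> cf cg; apply: cmp_ext (cmp_and (cmp_leq cf cg) (cmp_leq cg cf)) => x.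
by rewrite eqn_leq.
Qed.

Lemma cmp_sum (g : nat -> nat -> nat) h : cmp h ->
  cmp2 g -> cmp (fun x => \sum_(k < h x) g x k).
Proof.
move=> ch cg.
have c3 : cmp3 (fun x k r => r + g x k).
  apply: cmp_add; first by do 2!apply: cmp_snd; exact: cmp_id.
  apply: cmp2_app cg _ _; last apply: cmp_fst; last apply: cmp_snd;
    by [exact: cmp_id | apply: cmp_fst; exact: cmp_id].
apply: cmp_ext (cmp_rec (cmp_const 0) c3 ch) => x.
by elim: (h x) => [|n /= ->]; rewrite ?big_ord0 // big_ord_recr.
Qed.

End Closure.

(** * Bounded execution of programs *)

(** Sequencing of partial results, with 0 for no answer and [v.+1] for the answer [v]. *)
Definition bind (r : nat) (F : nat -> nat) : nat := if r is v.+1 then F v else 0.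

Lemma bind_succ r F y : bind r F = y.+1 -> exists2 v, r = v.+1 & F v = y.+1.
Proof. by case: r => [|v] //= E; exists v. Qed.

Lemma cmp_bind A f (F : nat -> nat -> nat) :
  computable_in A f -> cmp2 A F -> computable_in A (fun x => bind (f x) (F x)).
Proof.
move=> cf cF.
apply: cmp_ext (cmp_if (cmp_eq0 cf) (cmp_const A 0)
  (cmp2_app cF (cmp_id A) (cmp_pred cf))) => x.
by case: (f x).
Qed.

Lemma cmp_find A (b : nat -> nat -> bool) f :
  cmp2 A (fun x k => b x k) -> computable_in A f ->
  computable_in A (fun x => find (b x) (iota 0 (f x))).
Proof.
move=> cb cf.
apply: (@cmp_min _ (fun x y => ~~ ((y == f x) || b x y))).
- apply: cmp_not; apply: cmp_or; last exact: cb.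
  apply: cmp_eq; first by apply: cmp_snd; exact: cmp_id.
  by apply: (cmp_comp cf); apply: cmp_fst; exact: cmp_id.
- move=> x; have := find_size (b x) (iota 0 (f x)); rewrite size_iota leq_eqVlt.
  case/orP=> [->//|lt]; have : has (b x) (iota 0 (f x)) by rewrite has_find size_iota.
  by move=> /(nth_find 0); rewrite nth_iota // add0n => ->; rewrite orbT.
- move=> x z lt; have /= := before_find 0 lt.
  have zlt : z < f x.
    by rewrite (leq_trans lt) // -[leqRHS](size_iota 0) find_size.
  by rewrite nth_iota // add0n => ->; rewrite orbF (ltn_eqF zlt).
Qed.

(* [run A t e x] is [y + 1] if [e] outputs [y] on [x] with all oracle queries and
   all searches below [t], and [0] otherwise. *)
Fixpoint run (A : set nat) (t : nat) (e : code) (x : nat) : nat :=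
  match e with
  | Czero => 1
  | Csucc => x.+2
  | Cfst => (fstn x).+1
  | Csnd => (sndn x).+1
  | Coracle => if x < t then (char_fun A x).+1 else 0
  | Cpair f g => bind (run A t f x) (fun u => bind (run A t g x) (fun v => (pairn u v).+1))
  | Ccomp f g => bind (run A t g x) (run A t f)
  | Crec f g => nat_rect (fun=> nat) (run A t f (fstn x))
      (fun k r => bind r (fun v => run A t g (pairn (fstn x) (pairn k v)))) (sndn x)
  | Cmin f => let y := find (fun y => run A t f (pairn x y) <= 1) (iota 0 t) in
      if y < t then if run A t f (pairn x y) == 1 then y.+1 else 0 else 0
  end.

(** The test [<= 1] stops at the first [y] where [f] either has no answer (0) or outputs 0 (1); only
    the second case counts as success, as in [min_graph]. *)
Lemma run_min A t f x y : run A t (Cmin f) x = y.+1 <->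
  [/\ y < t, run A t f (pairn x y) = 1 &
      forall z, z < y -> exists v, run A t f (pairn x z) = v.+2].
Proof.
rewrite /=; set b := fun y => _ <= 1; split.
  case: ifP => // lt; case: eqP => // E [Ey]; move: lt E; rewrite Ey => lt E.
  split=> // z; rewrite -Ey => zlt.
  have := before_find 0 zlt; rewrite nth_iota; last by lia.
  rewrite /b add0n; case: (run _ _ _ _) => [|[|v]] // _; by exists v.
move=> [lt E zE]; suff -> : find b (iota 0 t) = y by rewrite lt E eqxx.
have -> : iota 0 t = iota 0 y ++ y :: iota y.+1 (t - y.+1).
  by rewrite -[t in LHS](subnKC lt) addSnnS iotaD.
rewrite find_cat; case: ifP => [/hasP[z]|_].
  by rewrite mem_iota /b => /andP[_ /zE[v ->]].
by rewrite /= /b E addn0 size_iota.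
Qed.

(** The use principle: a run that answers has queried the oracle only below [t]. *)
Lemma run_ext A B t t' e x y : t <= t' ->
  (forall i, i < t -> (i \in A) = (i \in B)) ->
  run A t e x = y.+1 -> run B t' e x = y.+1.
Proof.
move=> tt' AB; elim: e x y => [|||||f IHf g IHg|f IHf g IHg|f IHf g IHg|f IHf] x y //=.
- by case: ifP => // xt; rewrite (leq_trans xt tt') /char_fun AB.
- move=> /bind_succ[u /IHf-> /bind_succ[v /IHg->]].
  by move=> [<-].
- by move=> /bind_succ[u /IHg-> /IHf].
- elim: (sndn x) y => [|n IHn] y /=; first exact: IHf.
  by move=> /bind_succ[v /IHn-> /IHg].
- move=> /run_min[yt /IHf fy zy]; apply/run_min; split=> //; first exact: leq_trans tt'.
  by move=> z /zy[v /IHf fz]; exists v.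
Qed.

Lemma run_sound A t e x y : run A t e x = y.+1 -> eval A e x y.
Proof.
elim: e x y => [|||||f IHf g IHg|f IHf g IHg|f IHf g IHg|f IHf] x y.
1-4: by move=> [<-].
- by rewrite /=; case: ifP => // _ [<-].
- by move=> /= /bind_succ[u /IHf fu /bind_succ[v /IHg gv [<-]]]; exists u, v.
- by move=> /= /bind_succ[u /IHg gu /IHf fy]; exists u.
- rewrite /=; elim: (sndn x) y => [|n IHn] y /=; first exact: IHf.
  by move=> /bind_succ[v /IHn hv /IHg gy]; exists v.
- move=> /run_min[_ /IHf fy zy]; split=> // z /zy[v /IHf fz]; by exists v.
Qed.

Lemma run_complete A e x y : eval A e x y -> exists t, run A t e x = y.+1.
Proof.
have mono e' t t' x' y' : t <= t' -> run A t e' x' = y'.+1 -> run A t' e' x' = y'.+1.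
  by move=> tt'; apply: run_ext.
elim: e x y => [|||||f IHf g IHg|f IHf g IHg|f IHf g IHg|f IHf] x y;
  try by move=> /= ->; exists 0.
- by move=> /= ->; exists x.+1; rewrite /= ltnSn.
- move=> /= [u [v [/IHf[t ft] /IHg[t' gt] ->]]]; exists (t + t').
  by rewrite /= (mono _ _ _ _ _ (leq_addr _ _) ft) /= (mono _ _ _ _ _ (leq_addl _ _) gt).
- move=> /= [u /IHg[t gt] /IHf[t' ft]]; exists (t + t').
  by rewrite /= (mono _ _ _ _ _ (leq_addr _ _) gt) /= (mono _ _ _ _ _ (leq_addl _ _) ft).
- rewrite /=; elim: (sndn x) y => [|n IHn] y /=; first exact: IHf.
  move=> [v /IHn[t ht] /IHg[t' gt]]; exists (t + t').
  have /= := mono (Crec f g) t (t + t') (pairn (fstn x) n) v (leq_addr _ _).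
  rewrite !fst_pairn !snd_pairn => -> //=.
  exact: (mono _ _ _ _ _ (leq_addl _ _) gt).
- move=> /= [/IHf[t ft] zy].
  have [t' gt] : exists t, forall z, z < y -> exists v, run A t f (pairn x z) = v.+2.
    elim: y zy {t ft} => [|y IHy] zy; first by exists 0.
    have [z zlt|t ht] := IHy; first by apply: zy; exact: ltnW.
    have [v /IHf[t' ht']] := zy y (ltnSn y).
    exists (t + t') => z; rewrite ltnS leq_eqVlt => /orP[/eqP->|/ht[w hw]].
      by exists v; exact: (mono _ _ _ _ _ (leq_addl _ _) ht').
    by exists w; exact: (mono _ _ _ _ _ (leq_addr _ _) hw).
  (* The time must also exceed [y], because it bounds the search itself. *)
  exists (y.+1 + t + t'); apply/run_min; split; first by lia.
    by apply: mono ft; lia.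
  by move=> z /gt[v hv]; exists v; apply: mono hv; lia.
Qed.

(** The oracle may vary with the input, so that [X] can simulate [e] on all finite oracles. *)
Lemma run_cmp X (O : nat -> set nat) e m t x :
  cmp2 X (fun k i => char_fun (O k) i) ->
  computable_in X m -> computable_in X t -> computable_in X x ->
  computable_in X (fun z => run (O (m z)) (t z) e (x z)).
Proof.
move=> cO; have cid := cmp_id X.
have c1 (h : nat -> nat) : computable_in X h -> computable_in X (fun z => h (fstn z)).
  by move=> ch; apply: (cmp_comp ch); exact: cmp_fst.
have c2 (h : nat -> nat) : computable_in X h -> computable_in X (fun z => h (fstn (fstn z))).
  by move=> ch; exact: (c1 (fun z => h (fstn z)) (c1 _ ch)).
elim: e m t x => [|||||f IHf g IHg|f IHf g IHg|f IHf g IHg|f IHf] m t x cm ct cx /=.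
- exact: cmp_const.
- by do 2!apply: cmp_succ.
- by apply: cmp_succ; exact: cmp_fst.
- by apply: cmp_succ; exact: cmp_snd.
- apply: cmp_if; [exact: cmp_ltn|apply: cmp_succ|exact: cmp_const].
  exact: (cmp2_app cO).
- apply: cmp_bind; first exact: IHf.
  apply: cmp_bind; first by apply: IHg; exact: c1.
  apply: cmp_succ; apply: cmp_pairn; last exact: cmp_snd.
  by apply: cmp_snd; exact: cmp_fst.
- apply: cmp_bind; first exact: IHg.
  by apply: IHf; [exact: c1|exact: c1|exact: cmp_snd].
- apply: cmp_rec; last exact: cmp_snd.
    by apply: IHf => //; exact: cmp_fst.
  apply: cmp_bind; first by do 2!apply: cmp_snd.
  apply: IHg; [exact: c2|exact: c2|].
  apply: cmp_pairn; first by apply: cmp_fst; exact: c2.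
  apply: cmp_pairn; last exact: cmp_snd.
  by apply: cmp_fst; apply: cmp_snd; exact: cmp_fst.
- set h := fun z y => run (O (m z)) (t z) f (pairn (x z) y).
  have ch : cmp2 X h.
    apply: IHf; [exact: c1|exact: c1|apply: cmp_pairn; [exact: c1|exact: cmp_snd]].
  set y := fun z => find (fun y => h z y <= 1) (iota 0 (t z)).
  have cy : computable_in X y.
    apply: cmp_find ct; apply: cmp_leq; [exact: ch|exact: cmp_const].
  apply: (@cmp_if _ (fun z => y z < t z)); [exact: cmp_ltn| |exact: cmp_const].
  apply: (@cmp_if _ (fun z => h z (y z) == 1)); [|exact: cmp_succ|exact: cmp_const].
  apply: cmp_eq; [exact: cmp2_app|exact: cmp_const].
Qed.

(** * Compactness of Cantor space *)

Lemma cmp_half_odd A f : computable_in A f ->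
  computable_in A (fun x => (f x)./2) /\ computable_in A (fun x => odd (f x)).
Proof.
move=> cf.
have codd : computable_in A (fun x => odd (f x)).
  apply: cmp_ext (cmp_rec (cmp_const A 0) (_ : cmp3 A (fun _ _ r => r == 0)) cf).
    by move=> x; elim: (f x) => //= n ->; case: (odd n).
  by apply: cmp_eq0; do 2!apply: cmp_snd; exact: cmp_id.
split=> //.
(* The half of [n] is the least [h] with [n <= 2h + 1]. *)
apply: (@cmp_min _ (fun x h => f x - h.*2.+1)).
- have c1 : computable_in A (fun z => f (fstn z)).
    by apply: cmp_comp cf _; apply: cmp_fst; exact: cmp_id.
  have c2 : computable_in A (fun z => sndn z) by apply: cmp_snd; exact: cmp_id.
  apply: cmp_ext (cmp_sub c1 (cmp_succ (cmp_add c2 c2))) => z.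
  by rewrite addnn.
- by move=> x; lia.
- by move=> x z; lia.
Qed.

Lemma cmp_pow2 A f : computable_in A f -> computable_in A (fun x => 2 ^ f x).
Proof.
move=> cf.
apply: cmp_ext (cmp_rec (cmp_const A 1) (_ : cmp3 A (fun _ _ r => r + r)) cf).
  by move=> x; elim: (f x) => //= n ->; rewrite addnn -mul2n expnS.
by apply: cmp_add; do 2!apply: cmp_snd; exact: cmp_id.
Qed.

(** Finite sets are coded by binary expansions, so the subsets of [I_t] are those with a code below
    [2 ^ t]. *)
Definition bits (m : nat) : set nat := [set i | odd (iter i half m)].

Lemma in_bits m i : (i \in bits m) = odd (iter i half m).
Proof. by apply/idP/idP; rewrite inE. Qed.

Lemma cmp_bits A : cmp2 A (fun m i => char_fun (bits m) i).
Proof.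
have cid := cmp_id A.
apply: cmp_ext (_ : computable_in A (fun z => odd (iter (sndn z) half (fstn z)))).
  by move=> z; rewrite /char_fun in_bits.
apply: (cmp_half_odd _).2.
apply: cmp_ext (cmp_rec (cmp_fst cid) (_ : cmp3 A (fun _ _ r => r./2)) (cmp_snd cid)).
  by move=> z; elim: (sndn z) => //= n ->.
by apply: (cmp_half_odd _).1; do 2!apply: cmp_snd.
Qed.

Lemma bits_lt m t i : m < 2 ^ t -> i \in bits m -> i < t.
Proof.
rewrite in_bits; elim: i m t => [|i IHi] m [|t].
- by case: m.
- by [].
- by case: m => // _; rewrite iterSr /= iter_fix.
- by rewrite expnS iterSr => mt /IHi; apply; lia.
Qed.

Lemma bits_of (Y : set nat) t :
  exists2 m, m < 2 ^ t & forall i, (i \in bits m) = (i < t) && (i \in Y).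
Proof.
elim: t Y => [|t IHt] Y.
  by exists 0 => // i; rewrite in_bits iter_fix.
have [m mt mE] := IHt [set i | Y i.+1].
exists ((0 \in Y) + m.*2).
  by rewrite expnS; case: (0 \in Y); lia.
case=> [|i]; rewrite in_bits.
  by rewrite /= oddD odd_double addbF oddb.
rewrite iterSr half_bit_double -in_bits mE ltnS; congr andb.
Qed.

(** Dependent choice under an invariant; it provides paths through trees, nested classes and generic
    sequences of conditions. *)
Lemma dependent_seq (T : Type) (P : nat -> T -> Prop) (R : nat -> T -> T -> Prop) x0 :
  P 0 x0 -> (forall n x, P n x -> exists y, P n.+1 y /\ R n x y) ->
  exists f, [/\ f 0 = x0, forall n, P n (f n) & forall n, R n (f n) (f n.+1)].
Proof.
move=> P0 PS.
have /choice[g gP] (p : nat * T) :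
    exists y, P p.1 p.2 -> P p.1.+1 y /\ R p.1 p.2 y.
  have [/PS[y yP]|nP] := pselect (P p.1 p.2); first by exists y.
  by exists p.2.
pose f := nat_rect (fun=> T) x0 (fun n x => g (n, x)).
have fP n : P n (f n) by elim: n => //= n /(gP (n, _))[].
by exists f; split=> // n; have [] := gP (n, f n) (fP n).
Qed.

(** Weak König's lemma for the tree of prefixes described by [T]: a prefix with extensions of all
    heights ([ext]) can be prolonged by one bit, and the prefixes so chosen have a limit. *)
Lemma cantor_compact (T : set nat -> nat -> Prop) :
  (forall Y Z t, (forall i, i < t -> (i \in Y) = (i \in Z)) -> T Y t -> T Z t) ->
  (forall Y t t', t <= t' -> T Y t' -> T Y t) ->
  (forall t, exists Y, T Y t) -> exists Y, forall t, T Y t.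
Proof.
move=> Tloc Tmono Tex.
pose agree t (Y Z : set nat) := forall i, i < t -> (i \in Y) = (i \in Z).
pose ext t Y := forall t', exists2 Z, agree t Y Z & T Z t'.
have [||f [_ fE fS]] := @dependent_seq _ ext (fun t Y Z => agree t Y Z) set0.
- by move=> t; have [Z TZ] := Tex t; exists Z.
- move=> t Y Yext.
  pose put (b : bool) : set nat := [set i | if i < t then Y i else b].
  have in_put b i : (i \in put b) = if i < t then i \in Y else b.
    by apply/idP/idP; rewrite inE /put /=; case: ifP => // _; rewrite inE.
  suff [b bE] : exists b, ext t.+1 (put b).
    by exists (put b); split=> // i it; rewrite in_put it.
  apply: contrapT => /forallNP nE.
  have /existsNP[t0 n0] := nE false; have /existsNP[t1 n1] := nE true.
  (* A witness above both heights of failure chooses one of the two bits at [t], and by monotonicity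
     refutes the failure of that bit. *)
  have [Z YZ TZ] := Yext (t0 + t1).
  have putZ : agree t.+1 (put (t \in Z)) Z.
    move=> i; rewrite ltnS leq_eqVlt in_put => /orP[/eqP->|it].
      by rewrite ltnn.
    by rewrite it YZ.
  case: (t \in Z) putZ => putZ; [apply: n1|apply: n0]; exists Z => //;
    by apply: Tmono TZ; lia.
have fmono i t t' : i < t -> t <= t' -> (i \in f t) = (i \in f t').
  move=> it; elim: t' => [|t' IH]; first by lia.
  rewrite leq_eqVlt => /orP[/eqP->//|tt']; rewrite IH //; apply: fS; lia.
exists [set i | f i.+1 i] => t; have [Z fZ TZ] := fE t t.
apply: Tloc TZ => i it; rewrite -fZ // -(fmono i i.+1) //.
Qed.

(** By compactness some level [t] makes [V] positive on all [2 ^ t] prefixes. [X] can search for the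
    first such level, and the sum of the values there is a bound independent of [Y]. *)
Lemma compact_bound X (V : set nat -> nat -> nat -> nat) :
  (forall Y Z t n, (forall i, i < t -> (i \in Y) = (i \in Z)) -> V Y t n = V Z t n) ->
  (forall Y t t' n, t <= t' -> 0 < V Y t n -> 0 < V Y t' n) ->
  cmp3 X (fun m t n => V (bits m) t n) ->
  (forall n Y, exists t, 0 < V Y t n) ->
  exists2 h, computable_in X h & forall n Y, exists2 t, 0 < V Y t n & V Y t n <= h n.
Proof.
move=> Vloc Vmono cV Vpos.
have gex n : exists t, \sum_(m < 2 ^ t) (V (bits m) t n == 0) == 0.
  apply: contrapT => /forallNP nE.
  have [|||Y VY] := @cantor_compact (fun Y t => V Y t n = 0).
  - by move=> Y Z t /Vloc->.
  - by move=> Y t t' tt' VY; have [//|/(Vmono _ _ _ _ tt')] := posnP (V Y t n); rewrite VY.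
  - move=> t; have /negP := nE t; rewrite sum_nat_eq0 negb_forall => /existsP[m].
    by rewrite eqb0 negbK => /eqP E; exists (bits m).
  by have [t] := Vpos n Y; rewrite VY.
pose g n := ex_minn (gex n).
have cid := cmp_id X.
have cg : computable_in X g.
  apply: (@cmp_min _ (fun n t => \sum_(m < 2 ^ t) (V (bits m) t n == 0))).
  - apply: (cmp_sum (g := fun z m => V (bits m) (sndn z) (fstn z) == 0)).
      by apply: cmp_pow2; exact: cmp_snd.
    apply: cmp_eq0; apply: (cmp3_app cV); first exact: cmp_snd.
      by apply: cmp_snd; exact: cmp_fst.
    by apply: cmp_fst; exact: cmp_fst.
  - by move=> n; rewrite /g; case: ex_minnP => t /eqP.
  - by move=> n t; rewrite /g; case: ex_minnP => t' _ tmin; apply: contraTN => /tmin; lia.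
exists (fun n => \sum_(m < 2 ^ g n) V (bits m) (g n) n).
  apply: (cmp_sum (g := fun n m => V (bits m) (g n) n)); first exact: cmp_pow2.
  apply: (cmp3_app cV); [exact: cmp_snd| |exact: cmp_fst].
  by apply: (cmp_comp cg); exact: cmp_fst.
move=> n Y; exists (g n).
  have [m mt mE] := bits_of Y (g n).
  rewrite -(@Vloc (bits m)) => [|i it]; last by rewrite mE it.
  rewrite /g in mt *; case: ex_minnP mt => t.
  by rewrite sum_nat_eq0 => /forallP Vt _ mt; have := Vt (Ordinal mt); rewrite eqb0 lt0n.
have [m mt mE] := bits_of Y (g n).
rewrite -(@Vloc (bits m)) => [|i it]; last by rewrite mE it.
by rewrite (bigD1 (Ordinal mt)) //= leq_addr.
Qed.

(** * The hyperimmune-free basis theorem *)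

(** No program is substituted for the oracle: [B] simulates the bounded runs of [e] and looks for
    the first time bound that gives an answer. *)
Lemma cmp_trans A B f :
  computable_in A f -> computable_in B (char_fun A) -> computable_in B f.
Proof.
move=> [e he] cA.
have tex x : exists t, 0 < run A t e x.
  by have [t ft] := run_complete (he x); exists t; rewrite ft.
pose T x := ex_minn (tex x).
have crun : cmp2 B (fun x t => run A t e x).
  apply: (run_cmp (O := fun=> A) e (m := fun=> 0)).
  - by apply: (cmp_comp cA); apply: cmp_snd; exact: cmp_id.
  - exact: cmp_const.
  - by apply: cmp_snd; exact: cmp_id.
  - by apply: cmp_fst; exact: cmp_id.
have cT : computable_in B T.
  apply: (@cmp_min _ (fun x t => run A t e x == 0)).
  - exact: cmp_eq0.
  - by move=> x; rewrite /T; case: ex_minnP => t; rewrite lt0n => /negbTE->.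
  - by move=> x t; rewrite /T; case: ex_minnP => t' _ tmin; rewrite eqb0 -lt0n;
      apply: contraTN => /tmin; lia.
apply: cmp_ext (cmp_pred (cmp2_app crun (cmp_id B) cT)) => x.
rewrite /T; case: ex_minnP => t; case E: (run _ _ _ _) => [//|v] _ _.
exact: eval_functional (run_sound E) (he x).
Qed.

Definition side (s : bool) (Y : set nat) : set nat := if s then Y else ~` Y.

Lemma in_side s Y i : (i \in side s Y) = (s == (i \in Y)).
Proof. by case: s; rewrite /side /= ?in_setC; case: (i \in Y). Qed.

Lemma cmp_meet_bits X s : cmp2 X (fun m i => char_fun (X `&` side s (bits m)) i).
Proof.
apply: cmp_ext (_ : computable_in X (fun z =>
  (sndn z \in X) && (s == (sndn z \in bits (fstn z))))) => [z|].
  by rewrite /char_fun in_setI in_side.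
apply: cmp_and; first by apply: cmp_oracle; apply: cmp_snd; exact: cmp_id.
case: s; first by apply: cmp_ext (cmp_bits X) => z; rewrite /char_fun; case: (_ \in _).
by apply: cmp_ext (cmp_not (cmp_bits X)) => z; case: (_ \in _).
Qed.

(** A test presents an effectively closed class relative to [X]: [Q Y t] means that [Y] has been
    expelled by stage [t], and the members are the sets never expelled. *)
Record is_test (X : set nat) (Q : set nat -> nat -> bool) : Prop := IsTest {
  test_local : forall Y Z t, (forall i, i < t -> (i \in Y) = (i \in Z)) -> Q Y t = Q Z t;
  test_mono : forall Y t t', t <= t' -> Q Y t -> Q Y t';
  test_cmp : cmp2 X (fun m t => Q (bits m) t) }.

Lemma run_agree A B t e x : (forall i, i < t -> (i \in A) = (i \in B)) ->
  run A t e x = run B t e x.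
Proof.
move=> AB; case E: (run A t e x) => [|v]; last by rewrite (run_ext (leqnn t) AB E).
case E': (run B t e x) => [//|v].
by rewrite (run_ext (leqnn t) _ E') in E => // i /AB.
Qed.

Lemma run_gt0_mono A t t' e x : t <= t' -> 0 < run A t e x -> 0 < run A t' e x.
Proof. by move=> tt'; case E: (run A t e x) => [//|v] _; rewrite (run_ext tt' _ E). Qed.

Lemma agree_meet X s Y Z t : (forall i, i < t -> (i \in Y) = (i \in Z)) ->
  forall i, i < t -> (i \in X `&` side s Y) = (i \in X `&` side s Z).
Proof. by move=> YZ i it; rewrite !in_setI !in_side YZ. Qed.

(** The dichotomy of hyperimmune-free forcing: [e] diverges at a fixed input for all members, or its
    values are dominated uniformly over the members. *)
Definition decided X s e (Q : set nat -> nat -> bool) :=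
  (exists n, forall Y t, 0 < run (X `&` side s Y) t e n -> Q Y t) \/
  (exists2 h, computable_in X h & forall Y, (forall t, ~~ Q Y t) ->
     forall n v, eval (X `&` side s Y) e n v -> v <= h n).

(** If some member makes [e] diverge at some [n], the class is cut down to all such members for that
    [n]. Otherwise [e] converges everywhere on the class and compactness bounds its values. *)
Lemma decide_test X s e Q : is_test X Q -> (exists Y, forall t, ~~ Q Y t) ->
  exists Q', [/\ is_test X Q', exists Y, forall t, ~~ Q' Y t,
                 forall Y t, Q Y t -> Q' Y t & decided X s e Q'].
Proof.
move=> tQ [Y0 Y0Q]; have [Qloc Qmono Qcmp] := tQ.
have cid := cmp_id X.
have [[n [Y YQ]]|nE] := pselect (exists n Y, forall t,
  ~~ (Q Y t || (0 < run (X `&` side s Y) t e n))).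
  exists (fun Y t => Q Y t || (0 < run (X `&` side s Y) t e n)); split.
  - split.
    + by move=> Z W t ZW; rewrite (Qloc _ _ _ ZW) (run_agree e n (agree_meet X s ZW)).
    + by move=> Z t t' tt' /orP[/(Qmono _ _ _ tt')->//|/(run_gt0_mono tt')->]; rewrite orbT.
    + apply: cmp_or; first exact: Qcmp.
      apply: cmp_ltn; first exact: cmp_const.
      apply: (run_cmp (O := fun m => X `&` side s (bits m)) e (x := fun=> n)).
      * exact: cmp_meet_bits.
      * exact: cmp_fst.
      * exact: cmp_snd.
      * exact: cmp_const.
  - by exists Y.
  - by move=> Z t ->.
  - by left; exists n => Z t ->; rewrite orbT.
exists Q; split=> //; first by exists Y0.
right.
(* The summand [Q Y t] makes the function positive outside of the class too, since compactness is
   applied to the whole Cantor space. *)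
have [||||h ch hP] := @compact_bound X
    (fun Y t n => Q Y t + run (X `&` side s Y) t e n).
- by move=> Z W t n ZW; rewrite (Qloc _ _ _ ZW) (run_agree e n (agree_meet X s ZW)).
- move=> Z t t' n tt'; rewrite !addn_gt0 => /orP[|/(run_gt0_mono tt')->]; last by rewrite orbT.
  by rewrite !lt0b => /(Qmono _ _ _ tt')->.
- apply: cmp_add; first by apply: (cmp2_app Qcmp); [exact: cmp_fst|apply: cmp_fst; exact: cmp_snd].
  apply: (run_cmp (O := fun m => X `&` side s (bits m)) e).
  + exact: cmp_meet_bits.
  + exact: cmp_fst.
  + by apply: cmp_fst; exact: cmp_snd.
  + by apply: cmp_snd; exact: cmp_snd.
- move=> n Y; apply: contrapT => /forallNP tE; apply: nE; exists n, Y => t.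
  by apply/negP => H; apply: (tE t); rewrite addn_gt0 lt0b.
exists h => // Y YQ n v ev; have [t t0 th] := hP n Y.
move: t0 th; rewrite (negbTE (YQ t)) add0n; case E: (run _ _ _ _) => [//|w] _ wh.
by rewrite (eval_functional ev (run_sound E)) ltnW.
Qed.

(** Stage [j] decides the program of code [j./2] on the side [odd j]. A common member of the nested
    classes exists by compactness, and a program total on one of its sides can only be in the
    dominated case. *)
Lemma bounded_basis X Q : is_test X Q -> (exists Y, forall t, ~~ Q Y t) ->
  exists2 Y, forall t, ~~ Q Y t &
    forall s f, computable_in (X `&` side s Y) f ->
      exists2 h, computable_in X h & forall n, f n <= h n.
Proof.
move=> tQ cQ.
have [||F [F0 FP FR]] := @dependent_seq _
  (fun _ Q => is_test X Q /\ exists Y, forall t, ~~ Q Y t)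
  (fun j Q Q' => (forall Y t, Q Y t -> Q' Y t) /\
     forall e, encode e = j./2 -> decided X (odd j) e Q') Q.
- by [].
- move=> j Q1 [tQ1 cQ1]; have [e eE] := encode_surj j./2.
  have [Q2 [tQ2 cQ2 Q12 dQ2]] := decide_test (odd j) e tQ1 cQ1.
  by exists Q2; do 2!split=> //; move=> e' e'E; have <- : e = e' by apply: encode_inj; rewrite eE.
have Fmono j k Y t : j <= k -> F j Y t -> F k Y t.
  move=> /subnKC<-; elim: (k - j) => [|d IH] Fj; rewrite ?addn0 // addnS.
  by apply: (FR _).1; exact: IH.
(* Testing only the classes [j <= t] at height [t] turns the intersection of all classes into one
   tree. *)
have [|||Y YF] := @cantor_compact (fun Y t => forall j, j <= t -> ~~ F j Y t).
- by move=> Y Z t YZ YF j /YF; rewrite (test_local (FP j).1 YZ).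
- move=> Y t t' tt' YF j jt; apply: contra (YF j _); last exact: leq_trans tt'.
  exact: test_mono (FP j).1 _ _ _ tt'.
- move=> t; have [Y YF] := (FP t).2; exists Y => j jt.
  by apply: contra (YF t); exact: Fmono.
have YFj j t : ~~ F j Y t.
  apply: contra (YF (j + t) j (leq_addr _ _)).
  by apply: test_mono (FP j).1 _ _ _ (leq_addl _ _).
exists Y => [t|s f [e he]]; first by rewrite -F0.
have jE : (s + (encode e).*2)./2 = encode e by rewrite half_bit_double.
have /= := (FR _).2 e (esym jE); rewrite oddD odd_double addbF oddb.
case=> [[n nP]|[h ch hP]].
  have [t ft] := run_complete (he n).
  by have /negP := YFj (s + (encode e).*2).+1 t; case; apply: nP; rewrite ft.
by exists h => // n; apply: hP (YFj _) _ _ (he n).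
Qed.

(** * Mathias forcing *)

Definition unbounded (W : set nat) := forall t, exists2 x, t <= x & W x.

Lemma infinite_unbounded W : infinite_set W <-> unbounded W.
Proof.
split=> [Winf t|Wub Wfin].
  apply: contrapT => nE; apply: Winf; apply: (@sub_finite_set _ _ `I_t); last exact: finite_II.
  by move=> x Wx; rewrite /= ltnNge; apply/negP => tx; apply: nE; exists x.
have /finite_seqP[s Ws] := Wfin; have [x] := Wub (sumn s).+1.
rewrite Ws /= => lt xs; have : x <= sumn s.
  by elim: s xs {Ws Wub Wfin lt} => //= y s IH; rewrite inE => /orP[/eqP->|/IH]; lia.
lia.
Qed.

Definition tail (X : set nat) (t : nat) : set nat := [set x | X x /\ t <= x].

Lemma unbounded_tail X t : unbounded X -> unbounded (tail X t).
Proof.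
by move=> Xub u; have [x ux Xx] := Xub (t + u); exists x; [|split=> //]; lia.
Qed.

Lemma cmp_tail X t : computable_in X (char_fun (tail X t)).
Proof.
apply: cmp_ext (_ : computable_in X (fun x => (x \in X) && (t <= x))) => [x|].
  by congr (nat_of_bool _); apply/andP/idP; rewrite !inE.
apply: cmp_and; first by apply: cmp_oracle; exact: cmp_id.
by apply: cmp_leq; [exact: cmp_const|exact: cmp_id].
Qed.

Lemma bits_union a D t : D `<=` `I_t -> exists m, bits m = bits a `|` D.
Proof.
(* As [a < 2 ^ a], the set [bits a] lies below [a]. *)
move=> Dt; have [m _ mE] := bits_of (bits a `|` D) (a + t).
exists m; apply/seteqP; split=> i.
  by move=> /mem_set; rewrite mE => /andP[_]; rewrite inE.
move=> aD; apply: set_mem; rewrite mE (mem_set aD) andbT.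
case: aD => [/mem_set/(bits_lt (ltn_expl a (ltnSn 1)))|/Dt /=]; lia.
Qed.

Section Forcing.
Variables (k : nat) (c : nat -> 'I_k).

(** The interval is empty if [h n < n], so the notion has content only for functions with
    [n <= h n]. *)
Definition escapes i (h : nat -> nat) := exists n, forall x, n <= x <= h n -> c x = i.

(* The complement of the color class [i] is [X]-hyperimmune. *)
Definition hyperimmune i X := forall h, computable_in X h -> escapes i h.

Definition all_hyperimmune X := forall i, hyperimmune i X.

Lemma all_hyperimmune_dom X Y : all_hyperimmune X ->
  (forall f, computable_in Y f -> exists2 h, computable_in X h & forall n, f n <= h n) ->
  all_hyperimmune Y.
Proof.
move=> hX YX i f /YX[h /hX-/(_ i)[n nP] fh]; exists n => x /andP[nx xf].
by apply: nP; rewrite nx (leq_trans xf).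
Qed.

Lemma all_hyperimmune_le X Y :
  all_hyperimmune X -> computable_in X (char_fun Y) -> all_hyperimmune Y.
Proof.
by move=> hX YX; apply: all_hyperimmune_dom hX _ => f /cmp_trans/(_ YX); exists f.
Qed.

(** This is vacuous when [e] is partial on [G], so forcing a divergence achieves it. *)
Definition forces_escape i e G := forall h, (forall x, eval G e x (h x)) -> escapes i h.

(** Inclusion of [bits m] in [Z] as a computable test, by counting violations; see [fitsP]. *)
Definition fits m (Z : set nat) t :=
  \sum_(i < t) ((val i \in bits m) && (val i \notin Z)) == 0.

Lemma fitsP m Z t : m < 2 ^ t -> fits m Z t <-> bits m `<=` Z.
Proof.
move=> mt; rewrite /fits sum_nat_eq0; split=> [/forallP mZ i|mZ].
  move=> /mem_set im; have := mZ (Ordinal (bits_lt mt im)).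
  by rewrite /= eqb0 im negbK inE.
apply/forallP => i; rewrite /= eqb0; apply/negP => /andP[im /negP]; apply.
by apply: mem_set; apply: mZ; apply: set_mem.
Qed.

(* The total output produced in [t] steps by [e] on [n], over all finite oracles
   extending [a] by elements of [X `&` side s Y]. *)
Definition outputs X a s e Y t n :=
  \sum_(m < 2 ^ t) fits m (X `&` side s Y) t * run (bits a `|` bits m) t e n.

(** The sum serves both as a disjunction, some extension converging when it is positive, and as a
    bound on every output. *)
Lemma outputs_gt0 X a s e Y t n : 0 < outputs X a s e Y t n ->
  exists m v, [/\ m < 2 ^ t, bits m `<=` X `&` side s Y,
    run (bits a `|` bits m) t e n = v.+1 & v < outputs X a s e Y t n].
Proof.
rewrite lt0n {1}/outputs sum_nat_eq0 negb_forall => /existsP[m].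
rewrite /= muln_eq0 negb_or eqb0 negbK => /andP[mf r0].
exists m, (run (bits a `|` bits m) t e n).-1; split=> //.
- exact: (fitsP _ (ltn_ord m)).1 mf.
- by rewrite prednK // lt0n.
- rewrite prednK ?lt0n // /outputs (bigD1 m) //= mf mul1n.
  exact: leq_addr.
Qed.

Lemma gt0_outputs X a s e Y t n m : m < 2 ^ t -> bits m `<=` X `&` side s Y ->
  0 < run (bits a `|` bits m) t e n -> 0 < outputs X a s e Y t n.
Proof.
move=> mt mY r0; rewrite /outputs (bigD1 (Ordinal mt)) //=.
by rewrite (_ : fits _ _ _ = true) ?mul1n ?ltn_addr //; exact: (fitsP _ mt).2 mY.
Qed.

Lemma outputs_local X a s e Y Z t n : (forall i, i < t -> (i \in Y) = (i \in Z)) ->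
  outputs X a s e Y t n = outputs X a s e Z t n.
Proof.
move=> YZ; apply: eq_bigr => m _.
suff -> : fits m (X `&` side s Y) t = fits m (X `&` side s Z) t by [].
by rewrite /fits; congr (_ == _); apply: eq_bigr => i _; rewrite (agree_meet X s YZ) /=.
Qed.

Lemma outputs_mono X a s e Y t t' n : t <= t' ->
  0 < outputs X a s e Y t n -> 0 < outputs X a s e Y t' n.
Proof.
move=> tt' /outputs_gt0[m [v [mt mY rv _]]]; apply: gt0_outputs mY _.
  by rewrite (leq_trans mt) // leq_exp2l.
by apply: run_gt0_mono tt' _; rewrite rv.
Qed.

Lemma outputs_cmp X a s e : cmp3 X (fun m t n => outputs X a s e (bits m) t n).
Proof.
have cid := cmp_id X.
apply: (cmp_sum (g := fun z m => fits m (X `&` side s (bits (fstn z))) (fstn (sndn z)) *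
  run (bits a `|` bits m) (fstn (sndn z)) e (sndn (sndn z)))).
  by apply: cmp_pow2; apply: cmp_fst; exact: cmp_snd.
apply: cmp_mul; last first.
  apply: (run_cmp (O := fun m => bits a `|` bits m)).
  - apply: cmp_ext (_ : computable_in X
      (fun z => (sndn z \in bits a) || (sndn z \in bits (fstn z)))) => [z|].
      by rewrite /char_fun in_setU.
    apply: cmp_or; last exact: cmp_bits.
    by apply: (cmp2_app (cmp_bits X)); [exact: cmp_const|exact: cmp_snd].
  - exact: cmp_snd.
  - by apply: cmp_fst; apply: cmp_snd; exact: cmp_fst.
  - by apply: cmp_snd; apply: cmp_snd; exact: cmp_fst.
apply: cmp_eq0.
apply: (cmp_sum (g := fun z i => (i \in bits (sndn z)) &&
  (i \notin X `&` side s (bits (fstn (fstn z)))))).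
  by apply: cmp_fst; apply: cmp_snd; exact: cmp_fst.
apply: cmp_and.
  apply: (cmp2_app (cmp_bits X)); last exact: cmp_snd.
  by apply: cmp_snd; exact: cmp_fst.
apply: cmp_not; apply: (cmp2_app (cmp_meet_bits X s)); last exact: cmp_snd.
by do 3!apply: cmp_fst.
Qed.

(** * Conditions and generic sets for the partition by [A] *)

Variable A : set nat.

Record valid (F : bool -> nat) (X : set nat) : Prop := Valid {
  valid_side : forall s, bits (F s) `<=` side s A;
  valid_unbounded : unbounded X;
  valid_hyperimmune : all_hyperimmune X }.

(** The second inclusion says at once that new elements come from the reservoir and that the
    reservoir shrinks, up to elements of [F s]. *)
Definition extends (F : bool -> nat) (X : set nat) (F' : bool -> nat) X' :=
  forall s, bits (F s) `<=` bits (F' s) /\ bits (F' s) `|` X' `<=` bits (F s) `|` X.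

Definition compatible (F : bool -> nat) (X : set nat) (G : bool -> set nat) :=
  forall s, bits (F s) `<=` G s /\ G s `<=` bits (F s) `|` X.

Lemma valid_tail F X t : valid F X -> valid F (tail X t).
Proof.
move=> [FA Xub Xh]; split=> //; first exact: unbounded_tail.
by apply: all_hyperimmune_le Xh _; exact: cmp_tail.
Qed.

Lemma add_elements F X s D t : valid F X -> D `<=` X `&` side s A -> D `<=` `I_t ->
  exists F', [/\ valid F' X, extends F X F' X & bits (F' s) = bits (F s) `|` D].
Proof.
move=> [FA Xub Xh] DX Dt; have [m mE] := bits_union (F s) Dt.
exists (fun s' => if s' == s then m else F s'); split; last by rewrite eqxx.
  split=> // s'; case: eqP => [->|_]; last exact: FA.
  by rewrite mE => x [/FA//|/DX[]].
move=> s'; case: eqP => [->|_]; last by split.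
rewrite mE; split=> x; first by left.
by move=> [[Fx|/DX[Xx _]]|Xx]; by [left|right].
Qed.

Lemma force_escape F X e i : valid F X -> exists F' X',
  [/\ valid F' X', extends F X F' X' &
   forall G, compatible F' X' G -> exists s, forces_escape i (e s) (G s)].
Proof.
move=> FXv; have [FA Xub Xh] := FXv.
(* Positive once either program converges on an extension drawn from its own part of the partition
   by [Y]. *)
pose V Y t n := outputs X (F true) true (e true) Y t n +
                outputs X (F false) false (e false) Y t n.
have Vloc Y Z t n : (forall i, i < t -> (i \in Y) = (i \in Z)) -> V Y t n = V Z t n.
  by move=> YZ; rewrite /V !(outputs_local _ _ _ _ _ YZ).
have Vmono Y t t' n : t <= t' -> 0 < V Y t n -> 0 < V Y t' n.
  move=> tt'; rewrite !addn_gt0 => /orP[]/(outputs_mono tt')-> //; by rewrite orbT.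
have cV : cmp3 X (fun m t n => V (bits m) t n) by apply: cmp_add; exact: outputs_cmp.
have VP s Y t n : 0 < outputs X (F s) s (e s) Y t n -> 0 < V Y t n.
  by rewrite /V addn_gt0; case: s => ->; rewrite ?orbT.
have [Vpos|] := pselect (forall n Y, exists t, 0 < V Y t n).
  have [h /Xh-/(_ i)[n nP] hV] := compact_bound Vloc Vmono cV Vpos.
  (* The bound [h] was computed without [A] but is valid for every partition, hence for the one
     whose parts may extend the stems. *)
  have [t Vt Vh] := hV n A.
  have [s [m [v [mt mA rv vV]]]] : exists s m v, [/\ m < 2 ^ t, bits m `<=` X `&` side s A,
    run (bits (F s) `|` bits m) t (e s) n = v.+1 & v < V A t n].
    move: Vt; rewrite addn_gt0 => /orP[]/outputs_gt0[m [v [mt mA rv vV]]];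
      [exists true|exists false]; exists m, v; split=> //; rewrite /V; lia.
  have [|F' [F'v FF' F'E]] := @add_elements F X s (bits m) t FXv mA.
    by move=> j /mem_set /(bits_lt mt).
  (* The computation queries its oracle only below [t], so cutting the reservoir there preserves
     it. *)
  exists F', (tail X t); split; first exact: valid_tail.
    move=> s'; have [FF's XX's] := FF' s'; split=> // x [F'x|[Xx _]]; apply: XX's; by [left|right].
  move=> G GP; exists s => f fP; exists n => x /andP[nx xf]; apply: nP.
  rewrite nx (leq_trans xf) // (_ : f n = v); first by rewrite (leq_trans _ Vh) // ltnW.
  have [F'G GF'] := GP s; apply: eval_functional (fP n) (run_sound (t := t) _).
  apply: run_ext rv => // j jt; rewrite -F'E; apply/idP/idP; rewrite !inE; first exact: F'G.
  by move=> /GF'[//|[_]]; rewrite leqNgt jt.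
(* The partitions that defeat the search at [n] form a nonempty effectively closed class, to which
   [bounded_basis] applies. *)
move=> /existsNP[n /existsNP[Y0 /forallNP Y0V]].
have [||Y YV Ydom] := @bounded_basis X (fun Y t => 0 < V Y t n).
- split.
  + by move=> Y Z t YZ; rewrite (Vloc _ _ _ _ YZ).
  + by move=> Y t t'; exact: Vmono.
  + apply: cmp_ltn; first exact: cmp_const.
    by apply: (cmp3_app cV); [apply: cmp_fst|apply: cmp_snd|apply: cmp_const]; exact: cmp_id.
- by exists Y0 => t; apply/negP.
have [s sub] : exists s, unbounded (X `&` side s Y).
  apply: contrapT => /forallNP nE.
  have /existsNP[t0 n0] := nE false; have /existsNP[t1 n1] := nE true.
  have [x xt Xx] := Xub (t0 + t1).
  by have [Yx|Yx] := pselect (Y x); [apply: n1|apply: n0]; exists x => //; lia.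
exists F, (X `&` side s Y); split.
- by split=> //; apply: all_hyperimmune_dom Xh (Ydom s).
- by move=> s'; split=> // x [Fx|[Xx _]]; by [left|right].
move=> G GP; exists s => f fP; exfalso.
(* A convergent computation from [G s] at [n] would use only finitely many elements of the
   restricted reservoir, a finite extension excluded by the choice of [Y]. *)
have [FG GF] := GP s; have [t rt] := run_complete (fP n).
have [m mt mE] := bits_of (G s `&` (X `&` side s Y)) t.
have /negP := YV t; apply; apply: (VP s); apply: (gt0_outputs mt).
  by move=> x /mem_set; rewrite mE => /andP[_]; rewrite inE => -[].
rewrite (@run_agree _ (G s)) ?rt // => j jt; rewrite in_setU mE jt /=.
apply/orP/idP; rewrite !inE; first by case=> [/FG//|[]].
by move=> Gj; have [Fj|XYj] := GF _ Gj; [left|right].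
Qed.

Lemma extends_trans F X F' X' F'' X'' :
  extends F X F' X' -> extends F' X' F'' X'' -> extends F X F'' X''.
Proof.
move=> FF' FF'' s; have [sub1 sub2] := FF' s; have [sub3 sub4] := FF'' s.
by split=> x; [move=> /sub1/sub3|move=> /sub4/sub2].
Qed.

(** Stage [j] adds to both stems an element at least [j], and applies [force_escape] if [j] codes
    two programs and a color. If both sides failed for a color, a bad program for each would
    contradict the stage that codes this pair. *)
Lemma generic_sides : all_hyperimmune setT ->
  (forall X, unbounded X -> all_hyperimmune X -> forall s, unbounded (X `&` side s A)) ->
  exists G : bool -> set nat,
    [/\ forall s, G s `<=` side s A, forall s, unbounded (G s) &
        forall i, exists s, hyperimmune i (G s)].
Proof.
move=> hT split_ub.
have add1 F X s t : valid F X -> exists F', [/\ valid F' X, extends F X F' X &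
    exists2 x, t <= x & bits (F' s) x].
  move=> FXv; have [FA Xub Xh] := FXv; have [x tx Xx] := split_ub X Xub Xh s t.
  have [||F' [F'v FF' F'E]] := @add_elements F X s [set x] x.+1 FXv.
  - by move=> y ->.
  - by move=> y -> /=.
  by exists F'; split=> //; exists x => //; rewrite F'E; right.
have [||p [_ pv pR]] := @dependent_seq ((bool -> nat) * set nat)
  (fun _ p => valid p.1 p.2)
  (fun j p q => [/\ extends p.1 p.2 q.1 q.2,
     forall s, exists2 x, j <= x & bits (q.1 s) x &
     forall e0 e1 (i : 'I_k), j = pairn (encode e0) (pairn (encode e1) (val i)) ->
       forall G, compatible q.1 q.2 G ->
       exists s, forces_escape i (if s then e1 else e0) (G s)]) (fun=> 0, setT).
- split=> //=; last by move=> t; exists t.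
  by move=> s x /mem_set; rewrite in_bits iter_fix.
- move=> j [F0 X0] /= v0.
  have [F1 [v1 ext1 [x1 jx1 Fx1]]] := add1 F0 X0 false j v0.
  have [F2 [v2 ext2 [x2 jx2 Fx2]]] := add1 F1 X0 true j v1.
  have ext02 := extends_trans ext1 ext2.
  have mem2 F' X' : extends F2 X0 F' X' -> forall s, exists2 x, j <= x & bits (F' s) x.
    move=> ext3 []; [exists x2|exists x1] => //; apply: (ext3 _).1 => //.
    exact: (ext2 _).1.
  have [[e0 [e1 [i jE]]]|nj] := pselect (exists e0 e1 (i : 'I_k),
      j = pairn (encode e0) (pairn (encode e1) (val i))).
    have [F3 [X3 [v3 ext3 GP]]] := force_escape (fun s => if s then e1 else e0) i v2.
    exists (F3, X3); split=> //; split=> /=; first exact: extends_trans ext02 ext3.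
      exact: mem2 ext3.
    move=> e0' e1' i'; rewrite jE => /pairn_inj[/encode_inj<- /pairn_inj[/encode_inj<- /ord_inj<-]].
    exact: GP.
  exists (F2, X0); split=> //; split=> //=; first by apply: (mem2 F2 X0) => s; split.
  by move=> e0 e1 i jE; case: nj; exists e0, e1, i.
pose G s : set nat := [set x | exists j, bits ((p j).1 s) x].
have ext_le j j' : j <= j' -> extends (p j).1 (p j).2 (p j').1 (p j').2.
  move=> /subnKC<-; elim: (j' - j) => [|d IH]; first by rewrite addn0 => s; split.
  by rewrite addnS; apply: extends_trans IH _; have [] := pR (j + d).
have Gp j : compatible (p j).1 (p j).2 G.
  move=> s; split=> [x|x [j' xj']]; first by exists j.
  have [jj'|/ltnW j'j] := leqP j j'; first by apply: (ext_le _ _ jj' s).2; left.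
  by left; exact: (ext_le _ _ j'j s).1.
exists G; split.
- by move=> s x [j xj]; exact: (valid_side (pv j)) xj.
- by move=> s t; have [_ /(_ s)[x tx px] _] := pR t; exists x => //; exists t.+1.
- move=> i; apply: contrapT => /forallNP nE.
  have Gbad s : exists e, ~ forces_escape i e (G s).
    apply: contrapT => /forallNP sE; apply: (nE s) => h [e he].
    by apply: (contrapT (sE e)).
  have [[e0 n0] [e1 n1]] := (Gbad false, Gbad true).
  have [_ _ /(_ e0 e1 i erefl G (Gp _))[]] := pR (pairn (encode e0) (pairn (encode e1) (val i))).
  by case.
Qed.

End Forcing.

(** * Three colors against two sides *)

Lemma side_avoiding (c : nat -> 'I_3) A : all_hyperimmune c set0 ->
  exists s G, [/\ G `<=` side s A, unbounded G &
    forall j, exists2 i, i != j & hyperimmune c i G].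
Proof.
move=> h0.
have hT : all_hyperimmune c setT.
  apply: all_hyperimmune_le h0 _; apply: cmp_ext (cmp_const _ 1) => x.
  by rewrite /char_fun mem_set.
have [split_ub|] := pselect (forall X, unbounded X -> all_hyperimmune c X ->
    forall s, unbounded (X `&` side s A)); last first.
  (* Here [X] has no element of [side s A] from [t] on, so its tail lies in the other side and is
     still hyperimmune for all colors. *)
  move=> /existsNP[X /not_implyP[Xub /not_implyP[Xh /existsNP[s /existsNP[t tP]]]]].
  exists (~~ s), (tail X t); split; [|exact: unbounded_tail|].
    move=> x [Xx tx]; apply: set_mem; rewrite in_side.
    suff : x \notin side s A by rewrite in_side; case: s {tP}; case: (x \in A).
    by apply/negP; rewrite inE => sx; apply: tP; exists x.
  move=> j; exists (if j == ord0 then ord_max else ord0).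
    by have [->|] := eqVneq j ord0; rewrite // eq_sym.
  exact: all_hyperimmune_le Xh (cmp_tail X t) _.
have [G [GA Gub Gh]] := generic_sides hT split_ub.
have /choice[f fP] := Gh.
(* By the pigeonhole principle two colors share a side, and one of them differs from [j]. *)
have [s sP] : exists s, forall j, exists2 i, i != j & f i = s.
  pose o1 : 'I_3 := Ordinal (isT : 1 < 3); pose o2 : 'I_3 := Ordinal (isT : 2 < 3).
  pose o0 : 'I_3 := Ordinal (isT : 0 < 3).
  have two a b : a != b -> f a = f b -> forall j, exists2 i, i != j & f i = f a.
    by move=> ab fab j; have [aj|] := eqVneq a j; [exists b; rewrite -?aj // eq_sym|exists a].
  have [E|n01] := eqVneq (f o0) (f o1); first by exists (f o0); exact: (two o0 o1).
  have [E|n02] := eqVneq (f o0) (f o2); first by exists (f o0); exact: (two o0 o2).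
  exists (f o1); apply: (two o1 o2) => //.
  by move: n01 n02; case: (f o0); case: (f o1); case: (f o2).
by exists s, (G s); split=> // j; have [i ij <-] := sP j; exists i.
Qed.

(** The next element of [H] from [n] on is a function [h] computable from [H], and [h n] itself puts
    the color [j] into the interval from [n] to [h n]. *)
Lemma hyperimmune_avoids (c : nat -> 'I_3) i j G H : i != j -> hyperimmune c i G ->
  unbounded H -> (forall n, H n -> c n = j) -> ~ turing_le H G.
Proof.
move=> ij Gi Hub Hj HG.
have nex n : exists x, (n <= x) && (x \in H).
  by have [x nx Hx] := Hub n; exists x; rewrite nx inE.
pose h n := ex_minn (nex n).
have ch : computable_in G h.
  apply: (@cmp_min _ (fun n x => ~~ ((n <= x) && (x \in H)))).
  - apply: cmp_not; apply: cmp_and.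
      by apply: cmp_leq; [apply: cmp_fst|apply: cmp_snd]; exact: cmp_id.
    by apply: (cmp_comp HG); apply: cmp_snd; exact: cmp_id.
  - by move=> n; rewrite /h; case: ex_minnP => x ->.
  - move=> n x; rewrite /h; case: ex_minnP => y _ ymin xy; rewrite eqb0 negbK.
    by apply: contraTN xy => /ymin; rewrite -leqNgt.
have [n nP] := Gi h ch; move: nP; rewrite /h; case: ex_minnP => x /andP[nx].
rewrite inE => /Hj cx _ /(_ x); rewrite nx leqnn cx => /(_ isT) E.
by rewrite E eqxx in ij.
Qed.

(** * A coloring computable in the halting problem *)

Lemma halting_encode e x :
  halting_problem (pairn (encode e) x) <-> exists y, eval set0 e x y.
Proof.
split=> [[e' [x' [/pairn_inj[/encode_inj-> ->]]]]//|ex].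
by exists e, x.
Qed.

(** This turns the question whether a value exceeds [k] into a single halting query, computed
    uniformly from the code of the program. *)
Lemma exceeds_code : exists2 q : nat -> nat, forall A, computable_in A q &
  forall e a k, halting_problem (pairn (q (encode e)) (pairn a k)) <->
                exists2 v, eval set0 e a v & k < v.
Proof.
have cid A := cmp_id A.
(* [Cmin d] halts on [pairn v k] if and only if [k < v]. *)
have [d dE] : computable_in set0 (fun z => (sndn (fstn z)).+1 - fstn (fstn z)).
  apply: cmp_sub; last by do 2!apply: cmp_fst.
  by apply: cmp_succ; apply: cmp_snd; exact: cmp_fst.
pose E e := Ccomp (Cmin d) (Cpair (Ccomp e Cfst) Csnd).
(* The code of [E e] as arithmetic in [n], following [encode]: 6 and 5 mark [Ccomp] and [Cpair],
   while 2 and 3 are [Cfst] and [Csnd]. *)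
exists (fun n => 6 + 4 * pairn (encode (Cmin d)) (5 + 4 * pairn (6 + 4 * pairn n 2) 3)).
  move=> A.
  have caff i f : computable_in A f -> computable_in A (fun n => i + 4 * f n).
    move=> cf; apply: cmp_add; first exact: cmp_const.
    by apply: cmp_mul; first exact: cmp_const.
  apply: (caff); apply: cmp_pairn; first exact: cmp_const.
  apply: (caff); apply: cmp_pairn; last exact: cmp_const.
  by apply: (caff); apply: cmp_pairn; last exact: cmp_const.
move=> e a k; rewrite -[6 + _]/(encode (E e)); apply: iff_trans (halting_encode _ _) _.
split=> [[y [u [v [w [[a' -> ev] -> ->]]] [du _]]]|[v ev kv]].
  exists v; first by rewrite fst_pairn in ev.
  have := eval_functional du (dE (pairn (pairn v (sndn (pairn a k))) y)).
  by rewrite !(fst_pairn, snd_pairn) => /esym/eqP; rewrite subn_eq0.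
exists 0, (pairn v k).
  exists v, k; split=> //; last exact: esym (snd_pairn a k).
  by exists a; first exact: esym (fst_pairn a k).
split=> //; have := dE (pairn (pairn v k) 0); rewrite !(fst_pairn, snd_pairn).
by move: kv; rewrite -subn_eq0 => /eqP->.
Qed.

Section Coloring.
Variable q : nat -> nat.
Hypothesis q_cmp : forall A, computable_in A q.
Hypothesis qP : forall e a k, halting_problem (pairn (q (encode e)) (pairn a k)) <->
  exists2 v, eval set0 e a v & k < v.

(* The block starting at [a] goes on past [k]. *)
Definition pending (a k : nat) : bool :=
  0 < \sum_(n < a.+1) char_fun halting_problem (pairn (q n) (pairn a k)).

(* The color of [k], paired with the start of its block. *)
Definition block : nat -> nat := nat_rect (fun=> nat) (pairn 0 0) (fun k r =>
  if pending (sndn r) k then r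
  else pairn (if fstn r == 2 then 0 else (fstn r).+1) k.+1).

Lemma blockS k : block k.+1 = if pending (sndn (block k)) k then block k
  else pairn (if fstn (block k) == 2 then 0 else (fstn (block k)).+1) k.+1.
Proof. by []. Qed.

Lemma pendingP a k :
  pending a k <-> exists e v, [/\ encode e <= a, eval set0 e a v & k < v].
Proof.
rewrite /pending lt0n sum_nat_eq0 negb_forall; split.
  move=> /existsP[n]; rewrite eqb0 negbK inE; have [e eE] := encode_surj n.
  by rewrite -eE => /qP[v ev kv]; exists e, v; rewrite eE -ltnS ltn_ord.
move=> [e [v [ea ev kv]]]; apply/existsP; exists (Ordinal (ea : encode e < a.+1)).
by rewrite eqb0 negbK inE; apply/qP; exists v.
Qed.

Lemma block_cmp : computable_in halting_problem block.
Proof.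
have cid := cmp_id halting_problem.
have cr : computable_in halting_problem (fun z => sndn (sndn z)) by do 2!apply: cmp_snd.
have ck : computable_in halting_problem (fun z => fstn (sndn z)).
  by apply: cmp_fst; exact: cmp_snd.
suff cg : cmp3 halting_problem (fun _ k r => if pending (sndn r) k then r
    else pairn (if fstn r == 2 then 0 else (fstn r).+1) k.+1).
  exact: cmp_rec (cmp_const _ _) cg cid.
apply: cmp_if; [|exact: cr|].
  apply: cmp_ltn; first exact: cmp_const.
  apply: (cmp_sum (g := fun z n => char_fun halting_problem
     (pairn (q n) (pairn (sndn (sndn (sndn z))) (fstn (sndn z)))))).
    by apply: cmp_succ; exact: cmp_snd.
  apply: cmp_oracle; apply: cmp_pairn.
    by apply: (cmp_comp (q_cmp _)); exact: cmp_snd.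
  by apply: cmp_pairn; [do 3!apply: cmp_snd|apply: cmp_fst; apply: cmp_snd]; exact: cmp_fst.
apply: cmp_pairn; last exact: cmp_succ.
apply: cmp_if; [|exact: cmp_const|by apply: cmp_succ; exact: cmp_fst].
by apply: cmp_eq; [exact: cmp_fst|exact: cmp_const].
Qed.

Lemma block_lt3 k : fstn (block k) < 3.
Proof.
elim: k => [|k IH]; first by [].
rewrite blockS; case: ifP => // _; rewrite fst_pairn.
by case: ifP => // /eqP; lia.
Qed.

(** The block is finite because the finitely many programs with code at most [a] have a common bound
    on their values at [a]. *)
Lemma block_end a col : block a = pairn col a ->
  exists b, [/\ a < b, block b = pairn (if col == 2 then 0 else col.+1) b,
    forall k, a <= k < b -> block k = pairn col a &
    forall e v, encode e <= a -> eval set0 e a v -> v < b].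
Proof.
move=> aE.
have [M MP] : exists M, forall e v, encode e < a.+1 -> eval set0 e a v -> v <= M.
  elim: a.+1 => [|N [M MP]]; first by exists 0.
  have [e eE] := encode_surj N.
  have [w wP] : exists w, forall v, eval set0 e a v -> v <= w.
    have [[w ew]|nv] := pselect (exists v, eval set0 e a v).
      by exists w => v ev; rewrite (eval_functional ev ew).
    by exists 0 => v ev; case: nv; exists v.
  exists (M + w) => e' v; rewrite ltnS leq_eqVlt => /orP[/eqP|e'N] ev.
    by move: ev; rewrite -eE => /encode_inj-> /wP; lia.
  by have := MP e' v e'N ev; lia.
have kex : exists k, (a <= k) && ~~ pending a k.
  exists (a + M); rewrite leq_addr; apply/negP => /pendingP[e [v [ea /(MP e v ea)]]]; lia.
case: (ex_minnP kex) => k /andP[ak npk] kmin.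
have blockE j : a <= j -> j <= k -> block j = pairn col a.
  elim: j => [|j IH]; first by case: a aE {MP kex ak npk kmin}.
  rewrite leq_eqVlt => /orP[/eqP<-//|aj jk].
  rewrite blockS IH ?(ltnW jk) // snd_pairn; case: ifP => // /negbT npj.
  by have := kmin j; rewrite npj andbT => /(_ aj); lia.
exists k.+1; split=> //.
- rewrite blockS blockE // snd_pairn fst_pairn.
  by rewrite (negbTE npk).
- by move=> j /andP[aj jk]; exact: blockE.
- move=> e v ea ev; rewrite ltnS leqNgt; apply: contra npk => kv.
  by apply/pendingP; exists e, v.
Qed.

(** Blocks are nonempty, so block number [m] starts at [m] or later, late enough to take the
    programs with code at most [m] into account. *)
Lemma block_start m : exists2 a, m <= a & block a = pairn (m %% 3) a.
Proof.
elim: m => [|m [a ma aE]]; first by exists 0.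
have [b [ab bE _ _]] := block_end aE; exists b; first exact: leq_ltn_trans ab.
rewrite bE; congr (pairn _ _); case: eqP; lia.
Qed.

Lemma coloring_hyperimmune :
  all_hyperimmune (fun k => inord (fstn (block k)) : 'I_3) set0.
Proof.
(* This index is congruent to [i] modulo 3 and at least [encode e], so the block has color [i] and
   continues past [h a]. *)
move=> i h [e he]; have [a ma aE] := block_start (encode e * 3 + i).
have [b [ab bE blockE vb]] := block_end aE.
exists a => k /andP[ak kh]; rewrite blockE ?fst_pairn.
  rewrite modnMDl modn_small //; exact: inord_val.
by rewrite ak (leq_ltn_trans kh) // (vb e) //; lia.
Qed.

End Coloring.

Theorem theorem2 :
  exists c3 : RT1_instance 3,
    computable_in halting_problem (fun n => nat_of_ord (c3 n)) /\
    forall c2 : RT1_instance 2,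
      exists G : set nat,
        RT1_solution c2 G /\
        forall H : set nat, RT1_solution c3 H -> ~ turing_le H G.
Proof.
have [q q_cmp qP] := exceeds_code.
exists (fun k => inord (fstn (block q k))); split.
  apply: cmp_ext (cmp_fst (block_cmp q_cmp)) => k.
  by rewrite inordK // block_lt3.
move=> c2.
have [s [G [GA Gub Gh]]] :=
  side_avoiding [set n | c2 n = ord0] (coloring_hyperimmune qP).
exists G; split.
  split; first exact/infinite_unbounded.
  exists (if s then ord0 else ord_max) => n /GA; case: s {GA} => //= c2n.
  by apply/val_inj; move: c2n => /eqP; rewrite /= -val_eqE /=; case: (c2 n) => [[|[]]].
move=> H [/infinite_unbounded Hub [j Hj]]; have [i ij Gi] := Gh j.
exact: hyperimmune_avoids ij Gi Hub Hj.
Qed.
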